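(* Let $(X,d)$ be a metric space that is a $1$-snowflake. Then $q_X\ge 2$.
   Context: Snowflakes. For $s\in[1,\infty]$, a metric space $(X,d)$ is an $L^s$-metric space if for all $x,y,z\in X$: $d(x,y)\le (d(x,z)^s+d(z,y)^s)^{1/s}$ when $s<\infty$, and $d(x,y)\le\max\{d(x,z),d(z,y)\}$ when $s=\infty$. Two metric spaces $(X,d_X)$, $(Y,d_Y)$ are bi-Lipschitz equivalent if there are $L\ge 1$ and a bijection $\phi\colon Y\to X$ with $d_Y(x,y)/L\le d_X(\phi(x),\phi(y))\le L\,d_Y(x,y)$ for all $x,y\in Y$. The snowflake index of $(X,d)$ is $s_X=\sup\{s\in[1,\infty]: (X,d)\text{ is bi-Lipschitz equivalent to an }L^s\text{-metric space}\}$. $(X,d)$ is an $s$-snowflake if $(X,d)$ is bi-Lipschitz equivalent to an $L^s$-metric space and $s=s_X$. Metric cotype. $\mathbb{Z}_m^n$ denotes the $n$-fold product of the integers modulo $m$, and $\mathbf{e}_j$ the $j$th standard basis vector. For $f\colon \mathbb{Z}_m^n\to X$ ($m$ an even positive integer), $1\le j\le n$, and $\delta\in\{-1,0,1\}^n$, put $f_j(\epsilon)=f(\epsilon+\frac m2\mathbf{e}_j)$ and $f_\delta(\epsilon)=f(\epsilon+\delta)$. Let $1\le p\le q<\infty$. A metric space $(X,d)$ supports a $(p,q)$-metric cotype inequality if there are a constant $\Gamma\ge 1$ and a scaling function $m_{p,q}$ from the positive integers to the even positive integers such that for every positive integer $n$, with $m=m_{p,q}(n)$, every mapping $f\colon\mathbb{Z}_m^n\to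 X$ satisfies $$\mathbb{E}_{\epsilon\in\mathbb{Z}_m^n}\sum_{j=1}^n d(f(\epsilon),f_j(\epsilon))^p\le \Gamma^p m^p n^{1-(p/q)}\,\mathbb{E}_{\epsilon\in\mathbb{Z}_m^n}\mathbb{E}_{\delta\in\{-1,0,1\}^n} d(f(\epsilon),f_\delta(\epsilon))^p,$$ where the expectations are over uniformly distributed $\epsilon\in\mathbb{Z}_m^n$ and $\delta\in\{-1,0,1\}^n$. $q_X=\inf\{q\ge 1:\ \text{there is } 1\le p\le q \text{ such that } X \text{ supports a } (p,q)\text{-metric cotype inequality}\}$, with $\inf\emptyset=\infty$. *)

(* Defs.v *)
From HB Require Import structures.
From mathcomp Require Import all_boot all_order all_algebra.
From mathcomp Require Import all_classical all_reals all_analysis.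

Set Implicit Arguments.
Unset Strict Implicit.
Unset Printing Implicit Defensive.

Import Order.TTheory GRing.Theory Num.Theory.

Local Open Scope classical_set_scope.
Local Open Scope ring_scope.

(* The exponent -oo is junk; [Ls_metric s] is only used with 1 <= s. *)
Definition Ls_metric (R : realType) (s : \bar R) (X : metricType R) : Prop :=
  match s with
  | r%:E => forall x y z : X,
      mdist x y <= (mdist x z `^ r + mdist z y `^ r) `^ r^-1
  | +oo%E => forall x y z : X, mdist x y <= Num.max (mdist x z) (mdist z y)
  | -oo%E => False
  end.

Definition bilipschitz_equiv (R : realType) (X Y : metricType R) : Prop :=
  exists L : R, 1 <= L /\
  exists phi : Y -> X, bijective phi /\
  forall x y : Y,
    mdist x y / L <= mdist (phi x) (phi y) /\
    mdist (phi x) (phi y) <= L * mdist x y.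

Definition bilipschitz_to_Ls (R : realType) (s : \bar R) (X : metricType R) :
    Prop :=
  exists Y : metricType R, Ls_metric s Y /\ bilipschitz_equiv X Y.

Definition snowflake_index (R : realType) (X : metricType R) : \bar R :=
  ereal_sup [set s : \bar R | (1 <= s)%E /\ bilipschitz_to_Ls s X].

Definition snowflake (R : realType) (s : \bar R) (X : metricType R) : Prop :=
  [/\ (1 <= s)%E, bilipschitz_to_Ls s X & s = snowflake_index X].

Definition expect (R : realType) (T : finType) (F : T -> R) : R :=
  (\sum_(t : T) F t) / #|T|%:R.

(* The elements of {-1,0,1}^n are coded by {ffun 'I_n -> 'I_3}, the value k
   standing for k - 1. The expectation over delta is taken over this type and
   not over its image in 'Z_m^n, since -1 = 1 when m = 2. *)
Definition sign_vector (n m : nat) (delta : {ffun 'I_n -> 'I_3}) :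
    'rV['Z_m]_n :=
  \row_(j < n) ((delta j : nat)%:R - 1).

Definition half_shift (n m : nat) (j : 'I_n) : 'rV['Z_m]_n :=
  (m./2)%:R *: delta_mx 0 j.

Definition cotype_ineq (R : realType) (X : metricType R) (p q Gamma : R)
    (n m : nat) (f : 'rV['Z_m]_n -> X) : Prop :=
  expect (fun eps : 'rV['Z_m]_n =>
      \sum_(j < n) mdist (f eps) (f (eps + half_shift m j)) `^ p)
  <= Gamma `^ p * m%:R `^ p * n%:R `^ (1 - p / q) *
     expect (fun eps : 'rV['Z_m]_n =>
       expect (fun delta : {ffun 'I_n -> 'I_3} =>
         mdist (f eps) (f (eps + sign_vector m delta)) `^ p)).

(* 'Z_m is the ring of integers modulo m here, since m n is even and positive,
   hence at least 2. *)
Definition supports_cotype (R : realType) (X : metricType R) (p q : R) : Prop :=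
  exists (Gamma : R) (m : nat -> nat),
    [/\ 1 <= Gamma,
        forall n, (0 < n)%N -> (0 < m n)%N /\ ~~ odd (m n) &
        forall n, (0 < n)%N -> forall f : 'rV['Z_(m n)]_n -> X,
          cotype_ineq p q Gamma f].

Definition cotype_index (R : realType) (X : metricType R) : \bar R :=
  ereal_inf [set q%:E | q in
    [set q : R | 1 <= q /\ exists p : R, [/\ 1 <= p, p <= q &
                                            supports_cotype X p q]]].

(* Main.v *)
(* Consider chains x = x_0, ..., x_n = y with weight the sum of the
   d(x_i, x_{i+1})^s. If, for some N >= 2, every N-step path of step at most r
   has endpoints at distance at most (N - 1/2) r, then for the exponent s > 1
   with (N - 1/4)^s = N a chain of weight u^s spans at most a distance C u, as
   one sees by cutting it into N pieces of weight u^s / N. Hence the s-th root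
   of the infimum of the weights is an L^s-metric bi-Lipschitz to d.

   So a 1-snowflake contains, for each N and up to a factor 2, a rescaled copy
   of {0, ..., N}. Transport to it the map eps |-> sum_j tent(eps_j) from Z_m^n,
   where tent is the distance to 0 in Z_m. Shifts by m/2 move it by about m,
   while the increments along a random sign vector are orthogonal, so that
   their p-th moment is at most of order n^(p/2). The cotype inequality becomes
   n <= C n^(1 - p/q) n^(p/2), which forces q >= 2. *)
Require Import Defs.
From HB Require Import structures.
From mathcomp Require Import all_boot all_order all_algebra.
From mathcomp Require Import all_classical all_reals all_analysis.
From mathcomp Require Import zify ring lra.

Set Implicit Arguments.
Unset Strict Implicit.
Unset Printing Implicit Defensive.

Import Order.TTheory GRing.Theory Num.Theory.
Local Open Scope classical_set_scope.
Local Open Scope ring_scope.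

(** * Metric spaces built from distance functions *)

Record is_distance (R : realType) (T : Type) (D : T -> T -> R) : Prop :=
  { distance_refl : forall x, D x x = 0;
    distance_separated : forall x y, D x y = 0 -> x = y;
    distance_sym : forall x y, D x y = D y x;
    distance_triangle : forall y x z, D x z <= D x y + D y z }.

(** A copy of [T] indexed by the proof [dD], so that a second metric can be put on the points of [X]
    without clashing with the one they carry. *)
Definition distance_space (R : realType) (T : choiceType) (D : T -> T -> R)
  (dD : is_distance D) : Type := T.

HB.instance Definition _ (R : realType) (T : choiceType) (D : T -> T -> R)
  (dD : is_distance D) := Choice.on (distance_space dD).

HB.instance Definition _ (R : realType) (T : choiceType) (D : T -> T -> R)
    (dD : is_distance D) :=
  @isMetric.Build R (distance_space dD) D (distance_refl dD)
    (distance_separated dD) (distance_sym dD) (distance_triangle dD).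

(** * Chains and their weights *)

Fixpoint chain_weight (R : realType) (T : Type) (w : T -> T -> R) (x : T)
    (l : seq T) : R :=
  if l is y :: l' then w x y + chain_weight w y l' else 0.

Section Chains.
Context {R : realType} {T : Type} (w : T -> T -> R).
Hypothesis w_ge0 : forall x y, 0 <= w x y.

Lemma chain_weight_ge0 (x : T) (l : seq T) : 0 <= chain_weight w x l.
Proof. by elim: l x => //= y l IH x; rewrite addr_ge0. Qed.

Lemma chain_weight_cat (x : T) (l1 l2 : seq T) :
  chain_weight w x (l1 ++ l2) =
  chain_weight w x l1 + chain_weight w (last x l1) l2.
Proof. by elim: l1 x => /= [|y l IH] x; rewrite ?add0r // IH addrA. Qed.

Lemma chain_weight_rev (x : T) (l : seq T) : (forall x y, w x y = w y x) ->
  exists2 l', last (last x l) l' = x &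
    chain_weight w (last x l) l' = chain_weight w x l.
Proof.
move=> wC; elim: l x => [|y l IH] x /=; first by exists [::].
have [l' lastl' wl'] := IH y; exists (rcons l' x); rewrite ?last_rcons //.
by rewrite -cats1 chain_weight_cat lastl' wl' /= addr0 addrC wC.
Qed.

(** Cut at the first edge after which weight at most [t'] remains: before that edge more than [t']
    was left, so at most [t] has been spent. The edge itself belongs to neither piece. *)
Lemma chain_weight_split (t t' : R) (x : T) (l : seq T) :
    0 <= t -> 0 <= t' -> (0 < size l)%N -> chain_weight w x l <= t + t' ->
  exists l1 y l2, [/\ l = l1 ++ y :: l2, chain_weight w x l1 <= t &
    chain_weight w y l2 <= t'].
Proof.
move=> t0 t'0; elim: l x t t0 => [|y l IH] x t t0 //= _ wl.
have [wyl|wyl] := leP (chain_weight w y l) t'.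
  by exists [::], y, l.
have l0 : (0 < size l)%N.
  by case: (l) wyl => //=; rewrite ltNge t'0.
have txy : 0 <= t - w x y by lra.
have [|l1 [z [l2 [-> h1 h2]]]] := IH y _ txy l0; first by lra.
by exists (y :: l1), z, l2; split=> //=; lra.
Qed.

(* Each step covers a piece of weight at most [t] and the edge that follows. *)
Lemma chain_weight_pieces (d : T -> T -> R) (t a b : R) (n k : nat) (x : T)
    (l : seq T) :
    (forall x, d x x = 0) ->
    (forall x y, w x y <= 0 -> x = y) ->
    0 <= t -> 0 <= a -> 0 <= b ->
    (forall x y z, d x z <= d x y + d y z) ->
    (forall x l, (size l < n)%N -> chain_weight w x l <= t ->
      d x (last x l) <= a) ->
    (forall x y, w x y <= k%:R * t -> d x y <= b) ->
    (size l <= n)%N -> chain_weight w x l <= k%:R * t ->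
  exists z : nat -> T, [/\ z 0 = x, z k = last x l &
    forall i, (i < k)%N -> d (z i) (z i.+1) <= a + b].
Proof.
move=> d0 w0 t0 a0 b0 dtri da.
elim: k x l => [|k IH] x l db sl wl.
  exists (fun=> x); split=> //; rewrite mul0r in wl.
  elim: l x {sl} wl => //= y l IH x wl.
  have := chain_weight_ge0 y l; have := w_ge0 x y => h1 h2.
  by rewrite (w0 x y); [apply: IH|]; lra.
case: l sl wl => [|y0 l0] sl wl.
  by exists (fun=> x); split=> // i _; rewrite d0 addr_ge0.
have wl' : chain_weight w x (y0 :: l0) <= t + k%:R * t.
  by rewrite -[k.+1]add1n natrD mulrDl mul1r in wl.
have kt0 : 0 <= k%:R * t by rewrite mulr_ge0.
have [l1 [y [l2 [El w1 w2]]]] :=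
  @chain_weight_split _ _ x (y0 :: l0) t0 kt0 isT wl'.
rewrite El in sl wl *.
have [|||z [z0 zk zd]] := IH y l2.
- move=> u v uv; apply: db; apply: le_trans uv _.
  by rewrite ler_wpM2r // ler_nat.
- by rewrite size_cat /= in sl; lia.
- by [].
exists (fun i => if i is i'.+1 then z i' else x); split=> //.
  by rewrite zk last_cat.
case=> [_|i]; last by exact: zd.
rewrite z0; apply: le_trans (dtri _ (last x l1) _) _; apply: lerD.
  by apply: da => //; rewrite size_cat /= in sl; lia.
(* The edge at the cut weighs no more than the whole chain. *)
apply: db; move: wl; rewrite chain_weight_cat /=.
have := chain_weight_ge0 x l1; have := chain_weight_ge0 y l2; lra.
Qed.

End Chains.

(** * Inequalities for real powers *)

Lemma powR_le_inj (R : realType) (s x y : R) :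
  0 < s -> 0 <= y -> x `^ s <= y `^ s -> x <= y.
Proof.
move=> s0 y0; rewrite leNgt => /negP h; rewrite leNgt; apply/negP => yx.
by apply: h; rewrite gt0_ltr_powR ?nnegrE // (le_trans y0) // ltW.
Qed.

(** Write $x^s = x \cdot x^{s-1}$, likewise for $y$, and bound $x^{s-1}$ and $y^{s-1}$ by
    $(x+y)^{s-1}$. *)
Lemma powR_superadditive (R : realType) (s x y : R) :
  1 <= s -> 0 <= x -> 0 <= y -> x `^ s + y `^ s <= (x + y) `^ s.
Proof.
move=> s1 x0 y0; have s0 : 0 < s by apply: lt_le_trans s1.
rewrite -(mulr_powRB1 x0 s0) -(mulr_powRB1 y0 s0).
rewrite -(mulr_powRB1 (addr_ge0 x0 y0) s0) mulrDl.
by apply: lerD; apply: ler_wpM2l => //; apply: ge0_ler_powR;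
  rewrite ?nnegrE ?subr_ge0 ?lerDl ?lerDr ?addr_ge0.
Qed.

(** * Linear bound on chains when no path is nearly straight *)

Section ChainBound.
Context {R : realType} {X : metricType R} (N : nat) (s : R).
(** The gap $1/4$ between [M] and [M'] pays for the extra edge that each piece of a cut chain
    carries. *)
Let M : R := N%:R - 2^-1.
Let M' : R := N%:R - 4^-1.
Hypothesis N2 : (2 <= N)%N.
Hypothesis s0 : 0 < s.
Hypothesis M's : M' `^ s = N%:R.
Hypothesis no_path : forall (z : nat -> X) (r : R),
  (forall i, (i < N)%N -> mdist (z i) (z i.+1) <= r) ->
  mdist (z 0) (z N) <= M * r.
Let w (x y : X) : R := mdist x y `^ s.

(* [4 * M * M'] is the solution [C] of [M * (C / M' + 1) = C]. *)
Lemma mdist_le_chain_weight (x : X) (l : seq X) (u : R) :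
  0 <= u -> chain_weight w x l <= u `^ s ->
  mdist x (last x l) <= 4 * M * M' * u.
Proof.
have N2' : 2 <= N%:R :> R by rewrite ler_nat.
have M0 : 0 < M by rewrite /M; lra.
have M'0 : 0 < M' by rewrite /M'; lra.
(* Strong induction on the number of edges: the pieces are shorter chains, with [u / M'] in place of
   [u]. *)
have [n] := ubnP (size l); elim: n x l u => // n IH x l u sl u0 wl.
have Nt : N%:R * (u / M') `^ s = u `^ s.
  rewrite -M's -powRM; first by rewrite mulrC divfK // gt_eqF.
    exact: ltW.
  by rewrite divr_ge0 // ltW.
have a0 : 0 <= 4 * M * M' * (u / M').
  by rewrite !mulr_ge0 ?invr_ge0 // ?(ltW M0) ?(ltW M'0).
have [||||||||||z [z0 zN zd]] := @chain_weight_pieces R X w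
  (fun x y => powR_ge0 _ _) (@mdist R X) ((u / M') `^ s)
  (4 * M * M' * (u / M')) u n N x l.
- exact: mdistxx.
- move=> y z; rewrite le_eqVlt ltNge powR_ge0 orbF => /eqP /powR_eq0_eq0.
  exact: mdist_positivity.
- exact: powR_ge0.
- exact: a0.
- exact: u0.
- by move=> *; exact: metric_triangle.
- move=> y l' sl' wl'; apply: IH => //.
  by rewrite divr_ge0 // ltW.
- by move=> y z; rewrite Nt; apply: powR_le_inj.
- by rewrite -ltnS.
- by rewrite Nt.
have := no_path zd; rewrite z0 zN => /le_trans; apply.
rewrite -[4 * M * M' * (u / M')]mulrA [M' * _]mulrC divfK ?gt_eqF //.
have -> : M * (4 * M * u + u) = 4 * M * (M + 4^-1) * u by field.
rewrite /M'; suff -> : M + 4^-1 = N%:R - 4^-1 by [].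
by rewrite /M; field.
Qed.

End ChainBound.

(** * The chain infimum and the $L^s$-metric it defines *)

Section ChainInf.
Context {R : realType} {T : Type} (w : T -> T -> R).
Hypothesis w_ge0 : forall x y, 0 <= w x y.

(** For nonnegative [w], the largest function below [w] that vanishes on the diagonal and satisfies
    the triangle inequality. *)
Definition chain_inf (x y : T) : R :=
  inf [set chain_weight w x l | l in [set l | last x l = y]].

Lemma chain_inf_le (x : T) (l : seq T) :
  chain_inf x (last x l) <= chain_weight w x l.
Proof.
apply: ge_inf; last by exists l.
by exists 0 => _ [l' _ <-]; apply: chain_weight_ge0.
Qed.

Lemma le_chain_inf (c : R) (x y : T) :
  (forall l, last x l = y -> c <= chain_weight w x l) -> c <= chain_inf x y.
Proof.
move=> h; apply: lb_le_inf; first by exists (chain_weight w x [:: y]), [:: y].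
by move=> _ [l lastl <-]; apply: h.
Qed.

Lemma chain_inf_ge0 (x y : T) : 0 <= chain_inf x y.
Proof. by apply: le_chain_inf => l _; apply: chain_weight_ge0. Qed.

Lemma chain_inf_refl (x : T) : chain_inf x x = 0.
Proof.
by apply/eqP; rewrite eq_le chain_inf_ge0 andbT; apply: (chain_inf_le x [::]).
Qed.

Lemma chain_inf_triangle (y x z : T) :
  chain_inf x z <= chain_inf x y + chain_inf y z.
Proof.
rewrite -lerBlDl; apply: le_chain_inf => l2 <-.
rewrite lerBlDr -lerBlDl; apply: le_chain_inf => l1 <-.
have := chain_inf_le x (l1 ++ l2); rewrite last_cat chain_weight_cat; lra.
Qed.

Lemma chain_inf_sym (x y : T) : (forall x y, w x y = w y x) ->
  chain_inf x y = chain_inf y x.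
Proof.
move=> wC; wlog: x y / chain_inf y x < chain_inf x y => [h|].
  have [xy|yx|//] := ltgtP (chain_inf x y) (chain_inf y x).
    by symmetry; apply: h.
  exact: h.
rewrite ltNge => /negP[]; apply: le_chain_inf => l <-.
have [l' lastl' <-] := chain_weight_rev y l wC.
by rewrite -{2}lastl'; apply: chain_inf_le.
Qed.

End ChainInf.

(** The new metric is the $s$-th root of the chain infimum, whose triangle inequality is then the
    $L^s$ inequality. One-edge chains bound it by the old distance; the chain bound gives the
    converse up to [C]. *)
Lemma bilipschitz_to_Ls_of_chain_bound (R : realType) (X : metricType R)
    (s C : R) :
  1 <= s -> 1 <= C ->
  (forall (x : X) l u, 0 <= u ->
    chain_weight (fun x y : X => mdist x y `^ s) x l <= u `^ s ->
    mdist x (last x l) <= C * u) ->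
  bilipschitz_to_Ls s%:E X.
Proof.
move=> s1 C1 hC; have s0 : 0 < s by apply: lt_le_trans s1.
have C0 : 0 < C by apply: lt_le_trans C1.
pose w (x y : X) := mdist x y `^ s.
have w0 x y : 0 <= w x y by apply: powR_ge0.
have wC x y : w x y = w y x by rewrite /w metric_sym.
pose rho (x y : X) := chain_inf w x y `^ s^-1.
have rho0 x y : 0 <= rho x y by apply: powR_ge0.
have rhos x y : rho x y `^ s = chain_inf w x y.
  by rewrite /rho -powRrM mulVf ?gt_eqF // powRr1 // chain_inf_ge0.
have rho_le x y : rho x y <= mdist x y.
  apply: (powR_le_inj s0); first exact: mdist_ge0.
  rewrite rhos; apply: le_trans (chain_inf_le w0 x [:: y]) _.
  by rewrite /= addr0.
have le_rho x y : mdist x y <= C * rho x y.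
  rewrite mulrC -ler_pdivrMr //; apply: (powR_le_inj s0) => //.
  rewrite rhos; apply: le_chain_inf => // l <-.
  have W0 := chain_weight_ge0 w0 x l.
  (* [hC] is to be applied with [u] the $s$-th root of the weight. *)
  have Ws : chain_weight w x l = (chain_weight w x l `^ s^-1) `^ s.
    by rewrite -powRrM mulVf ?gt_eqF // powRr1.
  rewrite Ws; apply: ge0_ler_powR; rewrite ?nnegrE ?powR_ge0 ?(ltW s0) //.
    by rewrite divr_ge0 ?mdist_ge0 // ltW.
  by rewrite ler_pdivrMr // mulrC; apply: hC; rewrite ?powR_ge0 // -Ws.
have Drho : is_distance rho.
  split.
  - by move=> x; rewrite /rho chain_inf_refl // powR0 // invr_eq0 gt_eqF.
  - move=> x y rho_xy; apply: mdist_positivity; apply/eqP.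
    by rewrite eq_le mdist_ge0 andbT -(mulr0 C) -rho_xy.
  - by move=> x y; rewrite /rho chain_inf_sym.
  (* Superadditivity passes from the triangle inequality for $\rho^s$ to the one for $\rho$. *)
  - move=> y x z; apply: (powR_le_inj s0); first by rewrite addr_ge0.
    apply: le_trans (powR_superadditive s1 _ _) => //.
    by rewrite !rhos; apply: chain_inf_triangle.
exists (distance_space Drho); split.
  move=> x y z; change (rho x y <= (rho x z `^ s + rho z y `^ s) `^ s^-1).
  rewrite !rhos /rho.
  apply: ge0_ler_powR; rewrite ?nnegrE ?invr_ge0 ?(ltW s0) //.
  - exact: chain_inf_ge0.
  - by rewrite addr_ge0 ?chain_inf_ge0.
  - exact: chain_inf_triangle.
exists C; split=> //; exists id; split; first by exists id.
move=> x y.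
change (rho x y / C <= mdist (x : X) y /\ mdist (x : X) y <= C * rho x y).
split; last exact: le_rho.
rewrite ler_pdivrMr //; apply: le_trans (rho_le x y) _.
by rewrite ler_peMr ?mdist_ge0.
Qed.

(** * Nearly straight paths in a $1$-snowflake *)

(** If no [N]-step path has endpoints more than $(N - 1/2) r$ apart, the chain bound contradicts
    index $1$. Along a path that does, the triangle inequality loses less than $r/2$ in all, so
    every stretch of it is long. *)
Lemma snowflake1_rough_path (R : realType) (X : metricType R) (N : nat) :
  snowflake 1%E X -> (2 <= N)%N ->
  exists (z : nat -> X) (r : R), 0 < r /\
    forall i j, (i <= N)%N -> (j <= N)%N ->
      r / 2 * `|j%:R - i%:R| <= mdist (z i) (z j) <= r * `|j%:R - i%:R|.
Proof.
move=> [_ _ sX] N2; have N2' : 2 <= N%:R :> R by rewrite ler_nat.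
have [[z [r [zr lt_z]]]|no_path] := pselect (exists (z : nat -> X) (r : R),
    (forall i, (i < N)%N -> mdist (z i) (z i.+1) <= r) /\
    (N%:R - 2^-1) * r < mdist (z 0) (z N)); last first.
  have M'1 : 1 < N%:R - 4^-1 :> R by lra.
  have lnM' : 0 < ln (N%:R - 4^-1 : R) by apply: ln_gt0.
  (* The solution of $(N - 1/4)^s = N$; it exceeds $1$ because $1 < N - 1/4 < N$. *)
  pose s : R := ln N%:R / ln (N%:R - 4^-1).
  have s1 : 1 < s.
    by rewrite /s ltr_pdivlMr // mul1r ltr_ln ?posrE; lra.
  have s0 : 0 < s by lra.
  have M's : (N%:R - 4^-1) `^ s = N%:R.
    rewrite /powR gt_eqF; last by lra.
    by rewrite /s divfK ?gt_eqF // lnK // posrE; lra.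
  have : (1 < s%:E <= snowflake_index X)%E.
    rewrite lte_fin s1 /=; apply: ereal_sup_ubound; split.
      by rewrite lee_fin ltW.
    apply: (@bilipschitz_to_Ls_of_chain_bound _ _ s
      (4 * (N%:R - 2^-1) * (N%:R - 4^-1)) (ltW s1)); first by nra.
    move=> x l u u0; apply: mdist_le_chain_weight => // z r zr.
    by rewrite leNgt; apply/negP => lt_z; apply: no_path; exists z, r.
  by rewrite -sX => /andP[/lt_le_trans h /h]; rewrite ltxx.
have up i k : (i + k <= N)%N -> mdist (z i) (z (i + k)%N) <= r * k%:R.
  elim: k => [|k IH] ik; first by rewrite addn0 mdistxx mulr0.
  apply: le_trans (metric_triangle _ (z (i + k)%N) _) _.
  rewrite -[k.+1]addn1 natrD mulrDr mulr1 addnA addn1; apply: lerD.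
    by apply: IH; lia.
  by apply: zr; lia.
have r0 : 0 < r.
  have r_ge0 : 0 <= r by apply: le_trans (zr 0 _); rewrite ?mdist_ge0 //; lia.
  rewrite lt_neqAle r_ge0 andbT; apply/eqP => Er.
  by have := up 0 N (leqnn _); rewrite add0n; move: lt_z; rewrite -Er; lra.
exists z, r; split=> // i j iN jN.
wlog ij : i j iN jN / (i <= j)%N => [h|].
  by have [/h|/ltnW/h] := leqP i j; rewrite 1?metric_sym 1?distrC; apply.
rewrite -natrB // normr_nat.
have /= uij : mdist (z i) (z j) <= r * (j - i)%:R.
  by have := up i (j - i)%N; rewrite subnKC //; apply.
rewrite uij andbT; have [->|ij'] := eqVneq i j.
  by rewrite subnn mulr0 mdist_ge0.
have u0i : mdist (z 0) (z i) <= r * i%:R.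
  by have := up 0 i; rewrite add0n; apply; lia.
have ujN : mdist (z j) (z N) <= r * (N%:R - j%:R).
  by have := up j (N - j)%N; rewrite subnKC // natrB //; apply.
have := metric_triangle (z 0) (z i) (z N).
have := metric_triangle (z i) (z j) (z N).
(* Distinct indices give $j - i - 1/2 \ge (j - i)/2$. *)
have : i%:R + 1 <= j%:R :> R by rewrite natr1 ler_nat ltn_neqAle ij'.
rewrite natrB //; nra.
Qed.

(** * Expectations and second moments *)

Section Expect.
Context {R : realType} {T : finType}.
Implicit Types F G : T -> R.

Lemma expect_le F G : (forall t, F t <= G t) -> expect F <= expect G.
Proof. by move=> FG; rewrite ler_wpM2r ?invr_ge0 // ler_sum. Qed.

Lemma eq_expect F G : F =1 G -> expect F = expect G.
Proof. by move=> FG; rewrite /expect (eq_bigr _ (fun t _ => FG t)). Qed.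

Lemma expect_sum (I : finType) (F : I -> T -> R) :
  expect (fun t => \sum_i F i t) = \sum_i expect (F i).
Proof. by rewrite /expect exchange_big /= mulr_suml. Qed.

Lemma expectD F G : expect (fun t => F t + G t) = expect F + expect G.
Proof. by rewrite /expect big_split /= mulrDl. Qed.

Lemma expectZ (c : R) F : expect (fun t => c * F t) = c * expect F.
Proof. by rewrite /expect -mulr_sumr mulrA. Qed.

Lemma expectN F : expect (fun t => - F t) = - expect F.
Proof. by rewrite /expect sumrN mulNr. Qed.

Lemma expect_const (c : R) : (0 < #|T|)%N -> expect (fun _ : T => c) = c.
Proof.
move=> T0; rewrite /expect sumr_const -[c *+ _]mulr_natr mulfK // pnatr_eq0.
by rewrite -lt0n.
Qed.

Lemma expect_reindex (h : T -> T) F : injective h ->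
  expect (fun t => F (h t)) = expect F.
Proof. by move=> h_inj; rewrite /expect [in RHS](reindex_inj h_inj). Qed.

(* The reflections [h j] make the [Y j] pairwise orthogonal. *)
Lemma expect_sqr_sum_le (I : finType) (Y : I -> T -> R) (h : I -> T -> T) :
  (0 < #|T|)%N ->
  (forall j, injective (h j)) ->
  (forall j t, Y j (h j t) = - Y j t) ->
  (forall i j t, i != j -> Y i (h j t) = Y i t) ->
  (forall j t, `|Y j t| <= 1) ->
  expect (fun t => (\sum_j Y j t) ^+ 2) <= #|I|%:R.
Proof.
move=> T0 h_inj Yh Yh' Y1.
have -> : expect (fun t => (\sum_j Y j t) ^+ 2) =
    \sum_i \sum_j expect (fun t => Y i t * Y j t).
  rewrite -(eq_bigr _ (fun i _ => expect_sum (fun j t => Y i t * Y j t))).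
  rewrite -expect_sum; apply: eq_expect => t.
  by rewrite expr2 big_distrlr.
(* Reindexing by [h j] shows that this expectation equals its own opposite. *)
have Y0 i j : i != j -> expect (fun t => Y i t * Y j t) = 0.
  move=> ij; apply/eqP; rewrite -eqNr -expectN; apply/eqP.
  rewrite -[RHS](expect_reindex _ (h_inj j)); apply: eq_expect => t.
  by rewrite Yh Yh' // mulrN.
rewrite -sum1_card natr_sum; apply: ler_sum => i _.
rewrite (bigD1 i) //= big1 ?addr0; last first.
  by move=> j ji; rewrite Y0 // eq_sym.
rewrite -[leRHS](expect_const 1 T0); apply: expect_le => t.
by rewrite -expr2 -real_normK ?num_real // expr_le1.
Qed.

End Expect.

Lemma expect_pair (R : realType) (S T : finType) (F : S -> T -> R) :
  expect (fun s => expect (F s)) = expect (fun u : S * T => F u.1 u.2).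
Proof.
rewrite /expect -mulr_suml pair_bigA /= card_prod natrM invfM -mulrA.
by rewrite [X in _ * X]mulrC.
Qed.

(** With $y = x^2/a$ this is $y^{p/2} \le 1 + y$. When [a] bounds the second moment, it bounds the
    $p$-th moment by $2 a^{p/2}$, in place of Jensen's inequality. *)
Lemma powR_le_second_moment (R : realType) (p a x : R) :
  0 <= p <= 2 -> 0 < a -> 0 <= x ->
  x `^ p <= a `^ (p / 2) * (1 + a^-1 * x ^+ 2).
Proof.
move=> /andP[p0 p2] a0 x0; set y := a^-1 * x ^+ 2.
have y0 : 0 <= y by rewrite mulr_ge0 ?invr_ge0 ?(ltW a0) ?exprn_ge0.
have -> : x `^ p = a `^ (p / 2) * y `^ (p / 2).
  rewrite -powRM ?(ltW a0) // /y mulrA mulfV ?gt_eqF // mul1r.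
  by rewrite -powR_mulrn // -powRrM mulrC divfK // pnatr_eq0.
apply: ler_wpM2l; first exact: powR_ge0.
have [y1|y1] := leP y 1.
  apply: (@le_trans _ _ (1 `^ (p / 2))); last by rewrite powR1 lerDl.
  by apply: ge0_ler_powR; rewrite ?nnegrE //; lra.
apply: (@le_trans _ _ (y `^ 1)); first by apply: ler_powR; lra.
by rewrite powRr1 //; lra.
Qed.

(** * The tent function on the cyclic group *)

Definition tent (m x : nat) : nat := minn x (m - x).

Lemma modn_lt_double (m a : nat) : (a < m + m)%N ->
  (a %% m)%N = if (a < m)%N then a else (a - m)%N.
Proof.
move=> am; case: ltnP => h; first exact: modn_small.
by rewrite -{1}(subnK h) modnDr modn_small //; lia.
Qed.

(** The antipode of [x] is as far from $0$ as [x] is from $m/2$, and the distances of [x] from $0$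
    and $m/2$ add up to $m/2$. *)
Lemma tent_half (m x : nat) : ~~ odd m -> (x < m)%N ->
  (tent m ((x + m./2) %% m) + tent m x)%N = m./2.
Proof.
move=> m_even xm; have [h Em] : exists h, m = (h + h)%N.
  by exists m./2; rewrite addnn halfK (negbTE m_even) subn0.
have -> : m./2 = h by rewrite Em addnn doubleK.
rewrite /tent modn_lt_double; last by lia.
by case: ltnP => xh; clear m_even; lia.
Qed.

(* The values at [x] and its antipode agree a quarter period away from [0]; the
   translate [y] of such an [x] is then close to [0] or [m / 2]. *)
Lemma tent_antipode (m x : nat) : ~~ odd m -> (0 < m)%N -> (x < m)%N ->
  let dist a b := (a - b + (b - a))%N in
  let y := ((x + m %/ 4) %% m)%N in
  (m <= 4 * (dist (tent m ((x + m./2) %% m)) (tent m x) +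
             dist (tent m ((y + m./2) %% m)) (tent m y)))%N.
Proof.
move=> m_even m0 xm /=; set y := ((x + m %/ 4) %% m)%N.
have ym : (y < m)%N by rewrite ltn_mod.
have := tent_half m_even ym; have := tent_half m_even xm.
have [h Em] : exists h, m = (h + h)%N.
  by exists m./2; rewrite addnn halfK (negbTE m_even) subn0.
have -> : m./2 = h by rewrite Em addnn doubleK.
(* The quarter period may be rounded down, so $h$ is $2k$ or $2k + 1$. *)
have [k [Ek k1 k2]] : exists k, [/\ (m %/ 4)%N = k, (k + k <= h)%N &
    (h <= (k + k).+1)%N].
  by exists (m %/ 4)%N; split=> //; lia.
move: (tent m ((x + h) %% m)) (tent m ((y + h) %% m)) => a b.
rewrite /y Ek modn_lt_double; last by lia.
by rewrite /tent; case: (ltnP (x + k)%N m) => xk; clear y ym m_even Ek; lia.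
Qed.

Lemma tent_succ (m x : nat) : (1 < m)%N -> (x < m)%N ->
  (tent m (x.+1 %% m) <= (tent m x).+1)%N /\
  (tent m x <= (tent m (x.+1 %% m)).+1)%N.
Proof.
rewrite /tent => m1; rewrite leq_eqVlt => /predU1P[<-|xm].
  by rewrite modnn; lia.
by rewrite modn_small //; lia.
Qed.

Lemma natr_distn (R : realDomainType) (a b : nat) :
  (a - b + (b - a))%N%:R = `|a%:R - b%:R| :> R.
Proof.
have [ab|/ltnW ba] := leqP a b.
  by rewrite (eqP ab) add0n natrB // distrC ger0_norm // subr_ge0 ler_nat.
by rewrite (eqP ba) addn0 natrB // ger0_norm // subr_ge0 ler_nat.
Qed.

Definition tentZ (R : realType) (m : nat) (x : 'Z_m) : R := (tent m x)%:R.

Section Tent.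
Context {R : realType} (m : nat).
Hypothesis m1 : (1 < m)%N.
Local Notation T := (@tentZ R m).

Lemma val_addZp (x y : 'Z_m) : (x + y)%R = ((x + y) %% m)%N :> nat.
Proof. by rewrite /= [X in (_ %% X)%N = _](Zp_cast m1). Qed.

Lemma ltn_Zp (x : 'Z_m) : (x < m)%N.
Proof. by have := ltn_ord x; rewrite [X in (_ < X)%N](Zp_cast m1). Qed.

Lemma tentZ_succ (x : 'Z_m) : `|T (x + 1) - T x| <= 1.
Proof.
have [h1 h2] := tent_succ m1 (ltn_Zp x).
have Ex : tent m (x + 1)%R = tent m (x.+1 %% m).
  by rewrite val_addZp -[1]/(1%:R) val_Zp_nat // modnDmr addn1.
by rewrite /tentZ Ex ler_distl lerBlDr !natr1 !ler_nat h1 h2.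
Qed.

Lemma tentZ_step (x : 'Z_m) (k : 'I_3) :
  `|T (x + (k%:R - 1)) - T x| <= 1.
Proof.
case: k => -[|[|[|//]]] /= _; last 1 first.
- by rewrite -[2%:R]/(1 + 1) addrK tentZ_succ.
- rewrite sub0r distrC; have := tentZ_succ (x - 1); rewrite subrK; exact.
- by rewrite subrr addr0 subrr normr0 ler01.
Qed.

Lemma tentZ_antipode (x : 'Z_m) : ~~ odd m ->
  let h := (m./2)%:R in let y := x + (m %/ 4)%:R in
  m%:R / 4 <= `|T (x + h) - T x| + `|T (y + h) - T y|.
Proof.
move=> m_even /=.
have := tent_antipode m_even (ltnW m1) (ltn_Zp x) => /=.
rewrite -(ler_nat R) natrM natrD !natr_distn => H.
rewrite ler_pdivrMr // mulrC; apply: le_trans H _; rewrite /tentZ.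
by rewrite !val_addZp !val_Zp_nat // !modnDmr.
Qed.

End Tent.

(** * Sums of tents over the coordinates *)

Section TentSum.
Context {R : realType} (m n : nat).
Hypothesis m1 : (1 < m)%N.
Local Notation T := (@tentZ R m).
Implicit Types eps : 'rV['Z_m]_n.

(** Kept in [nat] because it will index the points of a path. *)
Definition tent_sum eps : nat := \sum_j tent m (eps ord0 j).

Lemma tent_sum_le eps : (tent_sum eps <= n * m)%N.
Proof.
rewrite -[n in (n * m)%N]card_ord -sum_nat_const; apply: leq_sum => j _.
by rewrite /tent geq_min ltnW // ltn_Zp.
Qed.

Lemma tent_sumB eps eps' :
  (tent_sum eps')%:R - (tent_sum eps)%:R =
  \sum_j (T (eps' 0 j) - T (eps 0 j)).
Proof. by rewrite /tent_sum !natr_sum -sumrB. Qed.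

(** Only coordinate [j] contributes. Averaging over [eps] and its translate by a quarter period, at
    least one of the two differences is $m/8$ or more. *)
Lemma expect_tent_half_shift (p : R) (j : 'I_n) : ~~ odd m -> 1 <= p ->
  (m%:R / 8) `^ p / 2 <= expect (fun eps : 'rV['Z_m]_n =>
    `|(tent_sum (eps + half_shift m j))%:R - (tent_sum eps)%:R| `^ p).
Proof.
move=> m_even p1; have p0 : 0 <= p by lra.
pose a (x : 'Z_m) : R := `|T (x + (m./2)%:R) - T x|.
have -> : expect (fun eps : 'rV['Z_m]_n =>
    `|(tent_sum (eps + half_shift m j))%:R - (tent_sum eps)%:R| `^ p) =
    expect (fun eps : 'rV['Z_m]_n => a (eps 0 j) `^ p).
  apply: eq_expect => eps; rewrite tent_sumB (bigD1 j) //= big1 => [|i ij].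
    by rewrite addr0 !mxE !eqxx mulr1.
  by rewrite !mxE (negbTE ij) andbF mulr0 addr0 subrr.
set E := expect _.
pose v : 'rV['Z_m]_n := (m %/ 4)%:R *: delta_mx 0 j.
have E' : expect (fun eps : 'rV['Z_m]_n => a ((eps + v) 0 j) `^ p) = E.
  exact: (expect_reindex (fun eps : 'rV['Z_m]_n => a (eps 0 j) `^ p)
    (addIr v)).
rewrite ler_pdivrMr // mulr_natr mulr2n -{2}E' -expectD.
have T0 : (0 < #|{: 'rV['Z_m]_n}|)%N by apply/card_gt0P; exists 0.
rewrite -[leLHS](expect_const _ T0); apply: expect_le => eps.
rewrite mxE !mxE !eqxx mulr1; move: (eps 0 j) => x.
have := tentZ_antipode (R := R) m1 x m_even => /=.
rewrite -/(a x) -/(a _); set b := a (_ + _) => ab.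
have a0 : 0 <= a x by rewrite normr_ge0.
have b0 : 0 <= b by rewrite normr_ge0.
have m80 : 0 <= m%:R / 8 :> R by rewrite divr_ge0 ?ler0n.
have [am|am] := leP (m%:R / 8) (a x).
  apply: (@le_trans _ _ (a x `^ p)); last by rewrite lerDl powR_ge0.
  by apply: ge0_ler_powR.
apply: (@le_trans _ _ (b `^ p)); last by rewrite lerDr powR_ge0.
by apply: ge0_ler_powR; rewrite ?nnegrE //; lra.
Qed.

(** Reversing the step in one coordinate is an involution on the pairs of a point and a sign vector;
    it negates that coordinate's increment and fixes the others, so the increments are
    orthogonal. *)
Lemma expect_sqr_tent_sign_vector :
  expect (fun u : 'rV['Z_m]_n * {ffun 'I_n -> 'I_3} =>
    ((tent_sum (u.1 + sign_vector m u.2))%:R - (tent_sum u.1)%:R : R) ^+ 2)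
  <= n%:R.
Proof.
pose st (u : 'rV['Z_m]_n * {ffun 'I_n -> 'I_3}) j : 'Z_m :=
  (u.2 j : nat)%:R - 1.
pose Y (j : 'I_n) (u : 'rV['Z_m]_n * {ffun 'I_n -> 'I_3}) : R :=
  T (u.1 0 j + st u j) - T (u.1 0 j).
(* Traverse the [j]-th step backwards. *)
pose h (j : 'I_n) (u : 'rV['Z_m]_n * {ffun 'I_n -> 'I_3}) :=
  (u.1 + st u j *: delta_mx 0 j,
   [ffun i => if i == j then rev_ord (u.2 i) else u.2 i]).
have h1 j u i : (h j u).1 0 i = if i == j then u.1 0 j + st u j else u.1 0 i.
  by rewrite !mxE /=; case: eqP => [->|_]; rewrite ?mulr1 // mulr0 addr0.
(* On ['I_3], [rev_ord] sends $k$ to $2 - k$ and so negates $k - 1$. *)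
have sth j u i : st (h j u) i = if i == j then - st u j else st u i.
  rewrite /st ffunE; case: eqP => [->|//] /=.
  by rewrite natrB; [ring | exact: ltn_ord].
rewrite (eq_expect (G := fun u => (\sum_j Y j u) ^+ 2)); last first.
  move=> u; congr (_ ^+ 2); rewrite tent_sumB; apply: eq_bigr => j _.
  by rewrite !mxE.
rewrite -[n in n%:R]card_ord; apply: (expect_sqr_sum_le (h := h)).
- by apply/card_gt0P; exists (0, [ffun=> ord0]).
- move=> j; apply: (can_inj (g := h j)) => -[eps delta].
  rewrite [RHS]surjective_pairing [LHS]surjective_pairing; congr pair.
    apply/rowP => i; rewrite !h1 sth !eqxx addrK.
    by case: eqP => [->|].
  by apply/ffunP => i; rewrite !ffunE; case: eqP => // _; rewrite rev_ordK.
- by move=> j u; rewrite /Y !h1 sth !eqxx addrK opprB.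
- by move=> i j u ij; rewrite /Y !h1 sth (negbTE ij).
- by move=> j u; apply: tentZ_step.
Qed.

End TentSum.

(** * Failure of metric cotype below $2$ *)

Lemma snowflake1_no_cotype (R : realType) (X : metricType R) (p q : R) :
  snowflake 1%E X -> 1 <= p -> p <= q -> q < 2 -> ~ supports_cotype X p q.
Proof.
move=> hX p1 pq q2 [Gamma [mf [Gamma1 mf_even cotype]]].
have p0 : 0 <= p by lra.
(* The exponent by which $n$ outgrows $n^{1 - p/q} n^{p/2}$; it is positive because $q < 2$. *)
pose a : R := p / q - p / 2.
have a0 : 0 < a.
  by rewrite subr_gt0 ltr_pM2l ?ltf_pV2 ?posrE; lra.
(* Here $16 = 2 \cdot 8$ comes from [r / 2] and [m / 8]; one factor $2$ of the $4$ from averaging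
   two translates, the other from the moment bound. *)
pose K : R := 4 * (16 * Gamma) `^ p.
suff bounded n : (0 < n)%N -> n%:R `^ a <= K.
  have K0 : 0 <= K by rewrite mulr_ge0 ?powR_ge0.
  have b0 : 0 <= K `^ a^-1 by apply: powR_ge0.
  have lt_n := archi_boundP b0.
  set n := Num.bound _ in lt_n.
  have n0 : (0 < n)%N by rewrite -(ltr_nat R); apply: le_lt_trans lt_n.
  have := bounded n n0; rewrite leNgt => /negP; apply.
  have {1}-> : K = (K `^ a^-1) `^ a by rewrite -powRrM mulVf ?gt_eqF // powRr1.
  by apply: gt0_ltr_powR; rewrite ?nnegrE.
move=> n0; move: (mf n) (mf_even n n0) (cotype n n0) => m [m0 m_even] cot.
have m1 : (1 < m)%N by case: (m) m0 m_even => [|[]].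
have nm2 : (2 <= n * m)%N by apply: leq_trans m1 _; rewrite leq_pmull.
have [z [r [r0 zr]]] := snowflake1_rough_path hX nm2.
have nR : 0 < n%:R :> R by rewrite ltr0n.
have mR : 0 < m%:R :> R by rewrite ltr0n.
(* The values of [tent_sum] are at most [n * m], so the path distorts their differences only between
   the factors [r / 2] and [r]. *)
have {cot} := cot (fun eps => z (tent_sum eps)).
rewrite /cotype_ineq expect_sum expect_pair.
set LHS := \sum_j _; set E := expect _ => cot.
have le_LHS : n%:R * ((r / 2) `^ p * ((m%:R / 8) `^ p / 2)) <= LHS.
  rewrite -[n in n%:R]card_ord mulr_natl -sumr_const; apply: ler_sum => j _.
  apply: le_trans (_ : (r / 2) `^ p * expect (fun eps : 'rV['Z_m]_n =>
    `|(tent_sum (eps + half_shift m j))%:R - (tent_sum eps)%:R| `^ p) <= _).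
    by rewrite ler_wpM2l ?powR_ge0 // expect_tent_half_shift.
  rewrite -expectZ; apply: expect_le => eps.
  rewrite -powRM ?divr_ge0 ?(ltW r0) //.
  apply: ge0_ler_powR;
    rewrite ?nnegrE ?mdist_ge0 ?mulr_ge0 ?invr_ge0 ?(ltW r0) //.
  by have /andP[] := zr _ _ (tent_sum_le m1 eps)
    (tent_sum_le m1 (eps + half_shift m j)).
(* The moment bound is used with $a = n$, which bounds the second moment. *)
have le_E : E <= r `^ p * (n%:R `^ (p / 2) * 2).
  apply: le_trans (_ : r `^ p * (n%:R `^ (p / 2) * (1 + n%:R^-1 *
    expect (fun u : 'rV['Z_m]_n * {ffun 'I_n -> 'I_3} =>
    ((tent_sum (u.1 + sign_vector m u.2))%:R - (tent_sum u.1)%:R : R) ^+ 2)))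
    <= _); last first.
    rewrite !ler_wpM2l ?powR_ge0 // -[leRHS]/(1 + 1) lerD2l.
    by rewrite mulrC ler_pdivrMr // mul1r expect_sqr_tent_sign_vector.
  have T0 : (0 < #|{: 'rV['Z_m]_n * {ffun 'I_n -> 'I_3}}|)%N.
    by apply/card_gt0P; exists (0, [ffun=> ord0]).
  rewrite -[X in X + n%:R^-1 * _](expect_const 1 T0).
  rewrite -!expectZ -expectD -!expectZ.
  apply: expect_le => -[eps delta] /=.
  set D := (_ - _ : R); apply: (@le_trans _ _ ((r * `|D|) `^ p)).
    apply: ge0_ler_powR;
      rewrite ?nnegrE ?mdist_ge0 ?mulr_ge0 ?normr_ge0 ?(ltW r0) //.
    by have /andP[] := zr _ _ (tent_sum_le m1 eps)
      (tent_sum_le m1 (eps + sign_vector m delta)).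
  rewrite powRM ?(ltW r0) // ler_wpM2l ?powR_ge0 //.
  rewrite -[D ^+ 2]real_normK ?num_real //.
  by apply: powR_le_second_moment; rewrite ?p0 //; lra.
have rp : 0 < r `^ p by apply: powR_gt0.
have mp : 0 < m%:R `^ p :> R by apply: powR_gt0.
have c16 : 0 < 16 `^ p :> R by apply: powR_gt0.
have Gp : 0 < Gamma `^ p by apply: powR_gt0; lra.
have np : 0 < n%:R `^ (1 - p / q) :> R by apply: powR_gt0.
have np2 : 0 < n%:R `^ (p / 2) :> R by apply: powR_gt0.
have En : n%:R = n%:R `^ (1 - p / q) * n%:R `^ (p / 2) * n%:R `^ a :> R.
  rewrite -!powRD; try by rewrite (gt_eqF nR) implybT.
  have -> : 1 - p / q + p / 2 + a = 1 by rewrite /a; ring.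
  by rewrite powRr1 // ltW.
have Erm : (r / 2) `^ p * ((m%:R / 8) `^ p / 2) =
    r `^ p * m%:R `^ p / (2 * 16 `^ p).
  have <- : (r / 2) `^ p * (m%:R / 8) `^ p * 16 `^ p = r `^ p * m%:R `^ p.
    rewrite -!powRM ?mulr_ge0 ?invr_ge0 ?(ltW r0) ?(ltW mR) //.
    by congr (_ `^ p); field.
  by field; rewrite gt_eqF.
have EK : K = 4 * (16 `^ p * Gamma `^ p) by rewrite /K powRM //; lra.
have le_n := le_trans le_LHS (le_trans cot (ler_wpM2l _ le_E)).
(* Chosen so that $A n^a$ is the lower bound for the left side and $A K$ the upper bound for the
   right side. *)
pose A := r `^ p * m%:R `^ p * n%:R `^ (1 - p / q) * n%:R `^ (p / 2) /
  (2 * 16 `^ p).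
have A0 : 0 < A by rewrite !(mulr_gt0, invr_gt0).
rewrite -(ler_pM2l A0) EK.
have -> : A * n%:R `^ a = n%:R * ((r / 2) `^ p * ((m%:R / 8) `^ p / 2)).
  by rewrite Erm [in RHS]En /A; field; rewrite gt_eqF.
apply: le_trans (le_n _) _.
  by rewrite !mulr_ge0 ?powR_ge0.
rewrite le_eqVlt; apply/orP; left; apply/eqP.
by rewrite /A; field; rewrite gt_eqF.
Qed.

Theorem theorem1p4 (R : realType) (X : metricType R) (hX : snowflake 1%E X) :
  (2%:E <= cotype_index X)%E.
Proof.
apply/ereal_infP => _ [q [q1 [p [p1 pq cot]]] <-].
rewrite lee_fin leNgt; apply/negP => q2.
exact: (snowflake1_no_cotype hX p1 pq q2 cot).
Qed.
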